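(* Let $D=\{(1,2),(1,3),(2,1),(2,2),(2,3),(3,1),(3,2),(3,3)\}$. For each of the following sets $T$, with $R=D\cup T$, we have $(123,R)\sim_d(132,R)$: (1) $T=\{(0,0)\}$; (2) $T=\{(0,1),(1,0)\}$; (3) $T=\{(0,0),(0,1),(1,0)\}$; (4) $T=\{(0,2),(2,0)\}$; (5) $T=\{(0,0),(0,2),(2,0)\}$; (6) $T=\{(0,1),(0,2),(1,0),(2,0)\}$; (7) $T=\{(0,0),(0,1),(0,2),(1,0),(2,0)\}$.
   Context: $S_n$ denotes the set of permutations of $[n]=\{1,\dots,n\}$, written $\pi=\pi_1\cdots\pi_n$. A mesh pattern of length $k$ is a pair $(\tau,R)$ with $\tau\in S_k$ and $R\subseteq\{0,1,\dots,k\}^2$ (the shaded boxes; box $(a,b)$ is the unit square $[a,a+1]\times[b,b+1]$ in the diagram of $\tau$). An occurrence of $(\tau,R)$ in $\pi\in S_n$ is a choice of indices $i_1<\dots<i_k$ such that $\pi_{i_1}\cdots\pi_{i_k}$ is order-isomorphic to $\tau$ and, with $i_0=0$, $i_{k+1}=n+1$, $v_1<\dots<v_k$ the values $\pi_{i_1},\dots,\pi_{i_k}$ sorted increasingly, $v_0=0$, $v_{k+1}=n+1$, for every $(a,b)\in R$ there is no index $m$ with $i_a<m<i_{a+1}$ and $v_b<\pi_m<v_{b+1}$. Mesh patterns $p,q$ are equidistributed, $p\sim_d q$, if for all $n,\ell\ge0$ the number of $\pi\in S_n$ with exactly $\ell$ occurrences of $p$ equals the number with exactly $\ell$ occurrences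 of $q$. *)

(* Defs.v *)
From mathcomp Require Import all_boot all_fingroup.

Set Implicit Arguments.
Unset Strict Implicit.
Unset Printing Implicit Defensive.

(* 'S_n permutes {0, .., n-1}: the one-line notation pi_1 ... pi_n of the
   paper is recovered by pi_(i+1) = (pi i).+1.  The shaded boxes keep their
   coordinates in {0, .., k}. *)
Definition mesh_pattern (k : nat) : Type :=
  ('S_k * {set 'I_k.+1 * 'I_k.+1})%type.

Section Occurrences.

Variables (k n : nat) (p : mesh_pattern k) (pi : 'S_n).

(* A choice of indices i_1 < ... < i_k is encoded as f : 'I_k -> 'I_n,
   with i_(j+1) = (f j).+1. *)
Implicit Type f : {ffun 'I_k -> 'I_n}.

Definition increasing f : bool :=
  [forall a : 'I_k, forall b : 'I_k, (a < b) ==> (f a < f b)].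

Definition order_iso f : bool :=
  [forall a : 'I_k, forall b : 'I_k,
     (pi (f a) < pi (f b)) == (p.1 a < p.1 b)].

(* i_0 = 0, i_1, ..., i_k, i_(k+1) = n + 1 *)
Definition index_bounds f : seq nat :=
  0 :: rcons [seq (f j).+1 | j <- enum 'I_k] n.+1.

(* v_0 = 0, v_1 < ... < v_k, v_(k+1) = n + 1 *)
Definition value_bounds f : seq nat :=
  0 :: rcons (sort leq [seq (pi (f j)).+1 | j <- enum 'I_k]) n.+1.

Definition box_empty f (a b : nat) : bool :=
  ~~ [exists m : 'I_n,
        (nth 0 (index_bounds f) a < m.+1 < nth 0 (index_bounds f) a.+1)
        && (nth 0 (value_bounds f) b < (pi m).+1
            < nth 0 (value_bounds f) b.+1)].

Definition occurrence f : bool :=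
  [&& increasing f, order_iso f
    & [forall ab in p.2, box_empty f (val ab.1) (val ab.2)]].

Definition num_occ : nat := #|[set f | occurrence f]|.

End Occurrences.

Definition equidistributed (k k' : nat)
    (p : mesh_pattern k) (q : mesh_pattern k') : Prop :=
  forall n l : nat,
    #|[set pi : 'S_n | num_occ p pi == l]| =
    #|[set pi : 'S_n | num_occ q pi == l]|.

(* Pairs in s with a coordinate larger than k are ignored. *)
Definition boxes (k : nat) (s : seq (nat * nat)) :
    {set 'I_k.+1 * 'I_k.+1} :=
  [set ab | (val ab.1, val ab.2) \in s].

Definition perm123 : 'S_3 := 1%g.

(* Fixes 0 and swaps 1 and 2, i.e. 132 in 1-based one-line notation. *)
Definition perm132 : 'S_3 := tperm (inord 1) (inord 2).

Definition shadedD : {set 'I_4 * 'I_4} :=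
  boxes 3 [:: (1, 2); (1, 3); (2, 1); (2, 2); (2, 3); (3, 1); (3, 2); (3, 3)].

(* Main.v *)
Require Import Defs.
From mathcomp Require Import all_boot all_fingroup.
From mathcomp Require Import zify.

Set Implicit Arguments.
Unset Strict Implicit.
Unset Printing Implicit Defensive.

(* The shading D says that, among the points above and to the right of the
   first point x of an occurrence, the two topmost ones are also the two
   rightmost ones; so x determines the occurrence, and 123 and 132 differ only
   in the relative order of this pair.  Swapping the values of the pair of x
   changes neither which points start an occurrence nor which of them have a
   common pair, and it turns around the pairs of exactly those points that have
   the same pair as x.  Boxes of T in row 0 or column 0, away from (0,3) and
   (3,0), do not notice the swap.  Doing one swap for each class of points with
   a common pair is therefore an injection that exchanges the numbers of
   occurrences of 123 and 132. *)

(* lia does not identify terms that differ by this wrapper, which the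
   elaboration of {perm 'I_n} inserts. *)
Ltac perm_lia := unfold reverse_coercion in *; lia.

Ltac prune := try solve [exfalso; lia].

(** * Pairs attached to points of a permutation, and the effect of a swap on them *)

Section Quadrants.

Variable n : nat.
Implicit Types (pi : 'S_n) (i j k a b c m : 'I_n).

(** This is what the shading [shadedD] demands. The order of [pi j] and [pi k] is left open, so that
    123 and 132 are treated at once. *)
Definition quadrant_pair pi i j k : Prop :=
  [/\ i < j < k, pi i < pi j, pi i < pi k
    & forall m, i < m -> pi i < pi m ->
        [|| m == j :> nat, m == k :> nat
          | [&& m < j, pi m < pi j & pi m < pi k]]].

Definition index_walls i j k : seq nat := [:: 0; i.+1; j.+1; k.+1; n.+1].

(** Minimum and maximum make the walls symmetric in the two values, so swapping the pair of [i]
    leaves them in place. *)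
Definition value_walls pi i j k : seq nat :=
  [:: 0; (pi i).+1; (minn (pi j) (pi k)).+1; (maxn (pi j) (pi k)).+1; n.+1].

Definition in_strip (s : seq nat) (t x : nat) : bool :=
  nth 0 s t < x.+1 < nth 0 s t.+1.

Definition box_free pi i j k (ab : nat * nat) : Prop :=
  forall m, ~~ (in_strip (index_walls i j k) ab.1 m
             && in_strip (value_walls pi i j k) ab.2 (pi m)).

(** The largest of the seven sets T, which contains the others. *)
Definition low_boxes : seq (nat * nat) :=
  [:: (0, 0); (0, 1); (0, 2); (1, 0); (2, 0)].

Ltac low_box_cases low :=
  move: low; rewrite !inE => /or4P[|||/orP[]] /eqP->;
  rewrite /in_strip /index_walls /=.

Lemma perm_val_eq pi a b : (pi a = pi b :> nat) <-> (a = b :> nat).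
Proof. by split=> [/val_inj/perm_inj -> //|/val_inj ->]. Qed.

Variant quadrant_spec pi i j k m : Prop :=
  | OutLeft of m <= i
  | OutBelow of pi m <= pi i
  | AtFirst of m = j :> nat & pi m = pi j :> nat
  | AtSecond of m = k :> nat & pi m = pi k :> nat
  | Inside of i < m < j & pi i < pi m < minn (pi j) (pi k).

Lemma quadrantP pi i j k m : quadrant_pair pi i j k -> quadrant_spec pi i j k m.
Proof.
case=> _ _ _ q; case: (leqP m i) => [|im]; first by constructor 1.
case: (leqP (pi m) (pi i)) => [|um]; first by constructor 2.
case/or3P: (q m im um) => [/eqP mj|/eqP mk|?]; last by constructor 5; lia.
  by constructor 3; rewrite ?perm_val_eq.
by constructor 4; rewrite ?perm_val_eq.
Qed.

Variant disposition pi i j k a b c : Prop :=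
  | SamePair of b = j & c = k
  | Right of i < a & k < a & pi a < pi i
  | RightLinked of i < a & j < a < k & pi a < pi i
      & (b == k :> nat) && (pi c < pi i) || (c == k :> nat) && (pi b < pi i)
  | Above of a < i & maxn (pi j) (pi k) < pi a
  | AboveLinked of a < i & minn (pi j) (pi k) < pi a < maxn (pi j) (pi k)
      & b < i
      & (c == j :> nat) && (pi k < pi j) || (c == k :> nat) && (pi j < pi k).

(** If one of [i], [a] lies above and to the right of the other, the pairs coincide. If [a] is to
    the lower right of [i], the points of its quadrant outside that of [i] are below [i], so those
    of [j], [k] right of [a] are topmost for [a]. If [a] is to the upper left, these points are left
    of [i], so those of [j], [k] above [a] are rightmost for [a]. *)
Lemma quadrant_pairP pi i j k a b c :
  quadrant_pair pi i j k -> quadrant_pair pi a b c ->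
  disposition pi i j k a b c.
Proof.
move=> Q Q'.
have [ijk uj uk _] := Q; have [abc xb xc _] := Q'.
have same : b = j :> nat -> c = k :> nat -> disposition pi i j k a b c.
  by move=> /val_inj-> /val_inj->; constructor 1.
have [ai|ia|/val_inj eia] := ltngtP a i; last subst i.
- have ja : pi j <> pi a :> nat by rewrite perm_val_eq; lia.
  have ka : pi k <> pi a :> nat by rewrite perm_val_eq; lia.
  have bi : b = i :> nat -> pi b = pi i :> nat by rewrite perm_val_eq.
  case: (quadrantP j Q') => *; prune; case: (quadrantP k Q') => *; prune;
    try solve [constructor 4; lia];
    case: (quadrantP b Q) => *; prune; case: (quadrantP c Q) => *; prune;
    solve [apply: same; lia | constructor 5; lia].
- have ja : a = j :> nat -> pi a = pi j :> nat by rewrite perm_val_eq.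
  have ka : a = k :> nat -> pi a = pi k :> nat by rewrite perm_val_eq.
  have ai : pi a <> pi i :> nat by rewrite perm_val_eq; lia.
  have bi : pi b <> pi i :> nat by rewrite perm_val_eq; lia.
  have ci : pi c <> pi i :> nat by rewrite perm_val_eq; lia.
  case: (quadrantP b Q) => *; prune; case: (quadrantP c Q) => *; prune;
    try solve [apply: same; lia];
    case: (quadrantP a Q) => *; prune; try solve [constructor 2; lia];
    case: (quadrantP j Q') => *; prune; case: (quadrantP k Q') => *; prune;
    solve [constructor 2; lia | constructor 3; lia].
- case: (quadrantP b Q) => *; prune; case: (quadrantP c Q) => *; prune;
    try solve [apply: same; lia];
    case: (quadrantP j Q') => *; prune; case: (quadrantP k Q') => *; prune;
    apply: same; lia.
Qed.

Variant swap_spec pi j k m : nat -> Prop :=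
  | SwapFirst of m = j :> nat : swap_spec pi j k m (pi k)
  | SwapSecond of m = k :> nat : swap_spec pi j k m (pi j)
  | SwapOther of m <> j :> nat & m <> k :> nat : swap_spec pi j k m (pi m).

Lemma swapP pi j k m : swap_spec pi j k m ((tperm j k * pi)%g m).
Proof.
rewrite permM; case: tpermP => [->|->|jm km]; first by constructor 1.
  by constructor 2.
by constructor 3 => /val_inj.
Qed.

Lemma swap_same pi a j k : quadrant_pair pi a j k ->
  quadrant_pair (tperm j k * pi)%g a j k.
Proof.
case=> [ajk xj xk q].
have Ea : (tperm j k * pi)%g a = pi a :> nat by case: swapP => //; perm_lia.
have Ej : (tperm j k * pi)%g j = pi k by rewrite permM tpermL.
have Ek : (tperm j k * pi)%g k = pi j by rewrite permM tpermR.
rewrite /quadrant_pair Ea Ej Ek.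
by split=> // m; have := q m; case: swapP; perm_lia.
Qed.

(** A low box lies left of the column of [a] or below its row, where the swap moves nothing. *)
Lemma swap_same_box pi a j k ab : quadrant_pair pi a j k -> ab \in low_boxes ->
  box_free pi a j k ab -> box_free (tperm j k * pi)%g a j k ab.
Proof.
case=> [ajk xj xk _] low free m.
have Ea : (tperm j k * pi)%g a = pi a :> nat by case: swapP => //; perm_lia.
have Ej : (tperm j k * pi)%g j = pi k by rewrite permM tpermL.
have Ek : (tperm j k * pi)%g k = pi j by rewrite permM tpermR.
have := free m; have := free j; have := free k.
rewrite /box_free /value_walls Ea Ej Ek minnC maxnC.
by low_box_cases low; case: swapP => //; perm_lia.
Qed.

Section Linked.

Variables (pi : 'S_n) (i j k a b c : 'I_n).
Hypotheses (Q : quadrant_pair pi i j k) (Q' : quadrant_pair pi a b c).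
Hypothesis bc_jk : ~ (b = j /\ c = k).

Let sigma := (tperm j k * pi)%g.

(* If b lies to the left of i, then only the topmost point of the quadrant of i
   can be shared with the pair of a; it is then the point at c, and the swap
   moves it.  Otherwise only the rightmost point, which stays in its column,
   can be shared. *)
Let c' := if b < i then tperm j k c else c.

(** In the cases [Right] and [Above], [j] and [k] both lie in column 0 or both in row 0 of the
    occurrence at [a], and the swap only permutes their rows or columns there. *)
Lemma swap_linked :
  [/\ quadrant_pair sigma a b c', (sigma b < sigma c') = (pi b < pi c)
    & forall ab, ab \in low_boxes ->
        box_free pi a b c ab -> box_free sigma a b c' ab].
Proof.
have [ijk uj uk _] := Q; have [abc xb xc q] := Q'.
have sm m : swap_spec pi j k m (sigma m) by apply: swapP.
have sa : sigma a = pi a :> nat.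
  case: sm => //; case: (quadrant_pairP Q Q') => [*||||];
    by [case: bc_jk | perm_lia].
have outside m : maxn (pi j) (pi k) < pi m -> sigma m = pi m :> nat.
  by case: sm => // /val_inj ->; perm_lia.
case: (quadrant_pairP Q Q') => [*|ia ka ai|ia jka ai link|ai mx|ai mm bi link];
  first by case: bc_jk.
- have c'E : c' = c by rewrite /c' ifN //; perm_lia.
  have sb : sigma b = pi b :> nat by case: sm => //; perm_lia.
  have sc : sigma c = pi c :> nat by case: sm => //; perm_lia.
  rewrite /box_free /value_walls /quadrant_pair c'E sa sb sc.
  split=> // [|ab low free m].
    by split=> // m; have := q m; case: sm => //; perm_lia.
  have := free m; have := free j; have := free k.
  by low_box_cases low; case: sm => //; perm_lia.
- have c'E : c' = c by rewrite /c' ifN //; perm_lia.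
  have bk : b = k :> nat -> pi b = pi k :> nat by move=> /val_inj->.
  have ck : c = k :> nat -> pi c = pi k :> nat by move=> /val_inj->.
  (* The shared point, at [k], stays above [i]; its partner is unmoved and below [i]. Hence their
     order and their minimum do not change. *)
  have [lt_s asb asc smin mi] :
    [/\ (sigma b < sigma c) = (pi b < pi c), pi a < sigma b, pi a < sigma c,
        minn (sigma b) (sigma c) = minn (pi b) (pi c)
      & minn (pi b) (pi c) < pi i < maxn (pi b) (pi c)].
    by case: (sm b) => *; case: (sm c) => *; split; perm_lia.
  rewrite /box_free /value_walls /quadrant_pair c'E sa.
  split=> // [|ab low free m].
    by split=> // m; have := q m; case: (sm m) => //; perm_lia.
  (* The point at i lies in box (0, 2) of the occurrence at a. *)
  have := free m; have := free i; have := free j; have := free k.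
  by low_box_cases low; rewrite ?smin; case: (sm m) => //; perm_lia.
- have sb : sigma b = pi b :> nat by apply: outside; perm_lia.
  have sc : sigma c = pi c :> nat by apply: outside; perm_lia.
  have c'E : c' = c.
    rewrite /c'; case: ifP => // _; case: tpermP => // cE;
      by move: xc mx; rewrite cE; perm_lia.
  rewrite /box_free /value_walls /quadrant_pair c'E sa sb sc.
  split=> // [|ab low free m].
    split=> // m; have := q m; have := q j; have := q k.
    by case: sm => //; perm_lia.
  have := free m; have := free j; have := free k.
  by low_box_cases low; case: sm => //; perm_lia.
- have sb : sigma b = pi b :> nat by case: sm => //; perm_lia.
  have c'E : c' = tperm j k c by rewrite /c' ifT //; perm_lia.
  have sc : sigma c' = pi c :> nat by rewrite c'E permM tpermK.
  have link' : [/\ c = j :> nat, c' = k :> nat, pi c = pi j :> nat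
                  & pi k < pi j] \/
               [/\ c = k :> nat, c' = j :> nat, pi c = pi k :> nat
                  & pi j < pi k].
    case/orP: link => /andP[/eqP/val_inj cE lt]; [left|right];
      by rewrite c'E cE ?tpermL ?tpermR.
  rewrite /box_free /value_walls /quadrant_pair sa sb sc.
  split=> // [|ab low free m].
    split=> // [|m]; first by case: link' => -[]; perm_lia.
    by have := q m; case: link' => -[]; case: sm => //; perm_lia.
  (* The point at i lies in box (2, 0) of the occurrence at a. *)
  have := free m; have := free i.
  by low_box_cases low; case: link' => -[]; case: sm => //; perm_lia.
Qed.

End Linked.

End Quadrants.

(** * The counting argument: one swap for each class of points *)

Section Toggling.

Variables (n : nat) (P : 'S_n -> 'I_n -> 'I_n -> 'I_n -> bool).
(** The new second position of a pair [b], [c] after the swap. It does not depend on the point [a]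
    that has this pair, so points with a common pair keep one. *)
Variable follow : 'I_n -> 'I_n -> 'I_n -> 'I_n -> 'I_n -> 'I_n.
Implicit Types (pi : 'S_n) (i j k a b c : 'I_n).

Hypothesis P_uniq : forall pi i j k b c,
  P pi i j k -> P pi i b c -> (b = j) * (c = k).
Hypothesis P_lt : forall pi i j k, P pi i j k -> j < k.
Hypothesis P_swap : forall pi i j k,
  P pi i j k -> P (tperm j k * pi)%g i j k.
Hypothesis P_follow : forall pi i j k a b c,
  P pi i j k -> P pi a b c -> ~ (b = j /\ c = k) ->
  let c' := follow i j k b c in let sigma := (tperm j k * pi)%g in
  P sigma a b c' /\ (sigma b < sigma c') = (pi b < pi c).

Definition occurs pi up i : bool :=
  [exists j, exists k, P pi i j k && ((pi j < pi k) == up)].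

(** By [P_uniq] a partial equivalence, reflexive exactly at the points that start an occurrence. *)
Definition same_pair pi a b : bool :=
  [exists j, exists k, P pi a j k && P pi b j k].

Lemma occursP pi up i :
  reflect (exists j k, P pi i j k /\ (pi j < pi k) = up) (occurs pi up i).
Proof.
apply: (iffP existsP) => [[j /existsP[k /andP[p /eqP e]]]|[j [k [p e]]]].
  by exists j, k.
by exists j; apply/existsP; exists k; rewrite p e eqxx.
Qed.

Lemma same_pairP pi a b :
  reflect (exists j k, P pi a j k /\ P pi b j k) (same_pair pi a b).
Proof.
apply: (iffP existsP) => [[j /existsP[k /andP[p e]]]|[j [k [p e]]]].
  by exists j, k.
by exists j; apply/existsP; exists k; rewrite p e.
Qed.

Lemma same_pair_at pi i j k a : P pi i j k -> same_pair pi i a = P pi a j k.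
Proof.
move=> p; apply/same_pairP/idP => [[b [c [p' q]]]|q]; last by exists j, k.
by move: q; rewrite !(P_uniq p p').
Qed.

Lemma swapK j k pi : (tperm j k * (tperm j k * pi))%g = pi.
Proof. by rewrite mulgA tperm2 mul1g. Qed.

Lemma P_swapE pi j k a : P (tperm j k * pi)%g a j k = P pi a j k.
Proof. by apply/idP/idP => /P_swap; rewrite ?swapK. Qed.

Lemma pair_neq b c j k : (b, c) != (j, k) -> ~ (b = j /\ c = k).
Proof. by move=> ne [eb ec]; rewrite eb ec eqxx in ne. Qed.

Lemma same_pair_swap pi i j k a b : P pi i j k ->
  same_pair (tperm j k * pi)%g a b = same_pair pi a b.
Proof.
have half rho : P rho i j k ->
    same_pair rho a b -> same_pair (tperm j k * rho)%g a b.
  move=> p /same_pairP[x [y [pa pb]]]; apply/same_pairP.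
  have [[ex ey]|ne] := eqVneq (x, y) (j, k).
    by exists j, k; rewrite !P_swapE -ex -ey.
  exists x, (follow i j k x y).
  have [? _] := P_follow p pa (pair_neq ne).
  by have [? _] := P_follow p pb (pair_neq ne).
move=> p; apply/idP/idP; last exact: half.
by move/(half _ (P_swap p)); rewrite swapK.
Qed.

(** The swap reverses its own pair and, by [P_follow], keeps the order of every other; the exclusive
    or records which case [a] is in. As the swap is an involution, one implication suffices. *)
Lemma occurs_swap pi i j k a up : P pi i j k ->
  occurs (tperm j k * pi)%g up a = occurs pi (up (+) P pi a j k) a.
Proof.
have flip rho : j < k ->
    ((tperm j k * rho)%g j < (tperm j k * rho)%g k) = ~~ (rho j < rho k).
  move=> jk; rewrite !permM tpermL tpermR -leqNgt ltn_neqAle.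
  by rewrite (inj_eq val_inj) (inj_eq perm_inj) -(inj_eq val_inj) gtn_eqF.
have half rho v : P rho i j k ->
    occurs rho v a -> occurs (tperm j k * rho)%g (v (+) P rho a j k) a.
  move=> p /occursP[b [c [pa <-]]]; apply/occursP.
  have [[eb ec]|ne] := eqVneq (b, c) (j, k).
    exists j, k; rewrite -eb -ec pa addbT; rewrite eb ec in pa *.
    by rewrite flip ?(P_lt p) // P_swapE.
  have [q e] := P_follow p pa (pair_neq ne).
  exists b, (follow i j k b c); split=> //; rewrite e.
  case paj: (P rho a j k); last by rewrite addbF.
  by have [eb ec] := P_uniq paj pa; case: (pair_neq ne).
move=> p; apply/idP/idP => [/(half _ _ (P_swap p))|/(half _ _ p)].
  by rewrite swapK P_swapE.
by rewrite addbK.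
Qed.

(** A canonical representative of each class, so that each pair is swapped only once. *)
Definition leader pi i : bool :=
  same_pair pi i i && [forall a : 'I_n, (a < i) ==> ~~ same_pair pi a i].

Definition toggle i pi : 'S_n :=
  if [pick jk | P pi i jk.1 jk.2 && leader pi i] is Some jk
  then (tperm jk.1 jk.2 * pi)%g else pi.

Variant toggle_spec i pi : 'S_n -> Prop :=
  | Toggled j k of leader pi i & P pi i j k :
      toggle_spec i pi (tperm j k * pi)%g
  | Idle of ~~ leader pi i : toggle_spec i pi pi.

Lemma toggleP i pi : toggle_spec i pi (toggle i pi).
Proof.
rewrite /toggle; case: pickP => [[j k] /= /andP[p l]|none].
  by constructor.
constructor; apply/negP=> l; have /andP[/same_pairP[j [k [p _]]] _] := l.
by have := none (j, k); rewrite /= p l.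
Qed.

Lemma same_pair_toggle i pi a b :
  same_pair (toggle i pi) a b = same_pair pi a b.
Proof. by case: toggleP => [j k _ p|//]; rewrite (same_pair_swap _ _ p). Qed.

Lemma leader_toggle i pi a : leader (toggle i pi) a = leader pi a.
Proof.
rewrite /leader same_pair_toggle; congr (_ && _).
by apply: eq_forallb => b; rewrite same_pair_toggle.
Qed.

Lemma occurs_toggle i pi a up : occurs (toggle i pi) up a =
  occurs pi (up (+) (leader pi i && same_pair pi i a)) a.
Proof.
case: toggleP => [j k -> p|/negPf->]; last by rewrite addbF.
by rewrite (occurs_swap _ _ p) (same_pair_at _ p).
Qed.

(** Toggling keeps both the leaders and the pair of [i], so the second application undoes the same
    swap. *)
Lemma toggleK i : involutive (toggle i).
Proof.
move=> pi; have := leader_toggle i pi i.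
case: toggleP => [j k -> p|/negPf li _]; last first.
  by case: toggleP => // ? ?; rewrite li.
move=> l; case: toggleP => [b c _ q|]; last by rewrite l.
by have [-> ->] := P_uniq (P_swap p) q; rewrite swapK.
Qed.

Definition toggles (s : seq 'I_n) pi := foldr toggle pi s.

Lemma toggles_inj s : injective (toggles s).
Proof.
elim: s => [//|i s IH] pi rho /= e.
by apply: IH; apply: (can_inj (toggleK i)).
Qed.

Lemma same_pair_toggles s pi a b :
  same_pair (toggles s pi) a b = same_pair pi a b.
Proof. by elim: s => //= i s; rewrite same_pair_toggle. Qed.

Lemma leader_toggles s pi a : leader (toggles s pi) a = leader pi a.
Proof. by elim: s => //= i s; rewrite leader_toggle. Qed.

Lemma leader_uniq pi i l a : leader pi i -> leader pi l ->
  same_pair pi i a -> same_pair pi l a -> i = l.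
Proof.
move=> /andP[_ /forallP li] /andP[_ /forallP ll].
move=> /same_pairP[j [k [pij paj]]] /same_pairP[b [c [plb pab]]].
have [eb ec] := P_uniq paj pab; rewrite {}eb {}ec in plb pab.
apply/val_inj/eqP; rewrite eqn_leq.
move: (li l) (ll i); rewrite (same_pair_at _ plb) (same_pair_at _ pij) pij plb.
by rewrite !implybF -!leqNgt => -> ->.
Qed.

(** The classes stay fixed throughout, and by [leader_uniq] and [uniq s] at most one entry of [s]
    reverses the pair of [a]; so the exclusive ors collapse to [has]. *)
Lemma occurs_toggles s pi a up : uniq s -> occurs (toggles s pi) up a =
  occurs pi (up (+) has (fun i => leader pi i && same_pair pi i a) s) a.
Proof.
elim: s up => [|i s IH] up /=; first by rewrite addbF.
case/andP=> is_ us; rewrite occurs_toggle leader_toggles same_pair_toggles.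
rewrite IH // -addbA; congr (occurs pi (up (+) _) a).
case li: (leader pi i && same_pair pi i a) => //=.
apply/negP => /hasP[l ls /andP[ll la]]; case/andP: li => li ia.
by move: is_; rewrite (leader_uniq li ll ia la) ls.
Qed.

Lemma leader_exists pi a : same_pair pi a a ->
  exists2 i, leader pi i & same_pair pi i a.
Proof.
move=> aa.
case: (@arg_minnP _ a (fun i => same_pair pi i a) val aa) => i ia mini.
exists i => //; have /same_pairP[j [k [p pa]]] := ia.
apply/andP; split; first by apply/same_pairP; exists j, k.
apply/forallP=> l; apply/implyP=> lti; apply/negP=> /same_pairP[b [c [q q']]].
have : same_pair pi l a by rewrite (same_pair_at _ q) !(P_uniq p q').
by move/mini; rewrite leqNgt lti.
Qed.

Lemma occurs_toggles_all pi a up :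
  occurs (toggles (enum 'I_n) pi) up a = occurs pi (~~ up) a.
Proof.
rewrite occurs_toggles ?enum_uniq //.
(* If [a] starts an occurrence, the leader of its class reverses its pair; otherwise both sides are
   false. *)
case aa: (same_pair pi a a).
  have [i li ia] := leader_exists aa.
  suff -> : has (fun i => leader pi i && same_pair pi i a) (enum 'I_n).
    by rewrite addbT.
  by apply/hasP; exists i; rewrite ?mem_enum ?li.
have no v : occurs pi v a = false.
  by apply/occursP=> -[j [k [p _]]]; move/same_pairP: aa; case; exists j, k.
by rewrite !no.
Qed.

(** The toggles are injective and exchange the two values of [up], which gives an inequality in each
    direction. *)
Lemma card_occurs_symmetric l :
  #|[set pi | #|[set i | occurs pi true i]| == l]| =
  #|[set pi | #|[set i | occurs pi false i]| == l]|.
Proof.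
have le up : #|[set pi | #|[set i | occurs pi up i]| == l]| <=
             #|[set pi | #|[set i | occurs pi (~~ up) i]| == l]|.
  rewrite -(card_imset _ (@toggles_inj (enum 'I_n))).
  apply/subset_leq_card/subsetP => _ /imsetP[pi + ->]; rewrite !inE.
  congr (_ == _); apply: eq_card => a.
  by rewrite !inE occurs_toggles_all negbK.
by apply/eqP; rewrite eqn_leq (le true) (le false).
Qed.

End Toggling.

(** * Translation of the mesh pattern definitions for length three *)

Definition at1 : 'I_3 := inord 1.
Definition at2 : 'I_3 := inord 2.

Lemma at1E : at1 = 1 :> nat. Proof. exact: inordK. Qed.

Lemma at2E : at2 = 2 :> nat. Proof. exact: inordK. Qed.

Lemma enum_I3 : enum 'I_3 = [:: ord0; at1; at2].
Proof.
apply: (inj_map val_inj); rewrite val_enum_ord /=.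
by rewrite !inordK.
Qed.

Lemma forall_I3 (p : pred 'I_3) : [forall x, p x] = [&& p ord0, p at1 & p at2].
Proof.
apply/forallP/and3P => [p_all|[p0 p1 p2] x]; first by split.
have: x \in enum 'I_3 by rewrite mem_enum.
by rewrite enum_I3 !inE => /or3P[] /eqP->.
Qed.

(** As [boxes] drops pairs out of range, the bound ensures that every member of [s] is represented
    in it. *)
Lemma forall_boxes k (s : seq (nat * nat)) (Q : nat * nat -> Prop) :
  all (fun ab => (ab.1 <= k) && (ab.2 <= k)) s ->
  (forall ab, ab \in boxes k s -> Q (val ab.1, val ab.2)) <->
  (forall ab, ab \in s -> Q ab).
Proof.
move=> /allP s_le; split=> Qs [a b] ab; last by apply: Qs; rewrite inE in ab.
have /andP[/= ak bk] := s_le _ ab.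
have := Qs (inord a, inord b); rewrite inE /= !inordK // => QQ.
exact: QQ.
Qed.

Section Bounds.

Variables (n : nat) (pi : 'S_n) (f : {ffun 'I_3 -> 'I_n}).

Lemma increasingE : increasing f = (f ord0 < f at1 < f at2).
Proof.
by rewrite /increasing forall_I3 !forall_I3 at1E at2E /=; lia.
Qed.

Lemma index_boundsE :
  index_bounds f = index_walls (f ord0) (f at1) (f at2).
Proof. by rewrite /index_bounds enum_I3. Qed.

Lemma value_boundsE :
  pi (f ord0) < pi (f at1) -> pi (f ord0) < pi (f at2) ->
  value_bounds pi f = value_walls pi (f ord0) (f at1) (f at2).
Proof.
move=> lt1 lt2; rewrite /value_bounds enum_I3 /value_walls.
set v := pi (f at1); set w := pi (f at2); set s := sort _ _.
suff -> : s = [:: (pi (f ord0)).+1; (minn v w).+1; (maxn v w).+1] by [].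
apply: (sorted_eq leq_trans anti_leq).
- by apply: sort_sorted; apply: leq_total.
- by rewrite /= /v /w; perm_lia.
- rewrite perm_sort /= perm_cons -/v -/w; case: (leqP v w) => _ //.
  by rewrite (perm_catC [:: _] [:: _]).
Qed.

End Bounds.

Definition shadedD_list : seq (nat * nat) :=
  [:: (1, 2); (1, 3); (2, 1); (2, 2); (2, 3); (3, 1); (3, 2); (3, 3)].

(** The list contains every box above and to the right of the first point except (1, 1). Since [pi]
    is injective, the only points on the inner walls there are those of the pair. *)
Lemma quadrant_pair_shadedD n (pi : 'S_n) i j k :
  quadrant_pair pi i j k <->
  [/\ i < j < k, pi i < pi j, pi i < pi k
    & forall ab, ab \in shadedD_list -> box_free pi i j k ab].
Proof.
split=> -[ijk uj uk q]; split=> //.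
  move=> ab; rewrite !inE => abD m; have := q m; move: abD.
  do 7?[case/orP]; move=> /eqP->;
    by rewrite /in_strip /index_walls /value_walls /=; perm_lia.
move=> m im um.
have box a b : (a, b) \in shadedD_list ->
  ~~ (in_strip (index_walls i j k) a m
      && in_strip (value_walls pi i j k) b (pi m)).
  by move/q/(_ m).
(* Column 3 and row 3 end at the wall [n.+1]. *)
have mn : m < n by []. have pn : pi m < n by [].
have [mj|jm|//] := ltngtP m j.
  have mj' : pi m <> pi j :> nat by rewrite perm_val_eq; lia.
  have mk' : pi m <> pi k :> nat by rewrite perm_val_eq; lia.
  have := box 1 2 isT; have := box 1 3 isT.
  by rewrite /in_strip /index_walls /value_walls /=; perm_lia.
have [mk|km|//] := ltngtP m k.
  have mj' : pi m <> pi j :> nat by rewrite perm_val_eq; lia.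
  have mk' : pi m <> pi k :> nat by rewrite perm_val_eq; lia.
  have := box 2 1 isT; have := box 2 2 isT; have := box 2 3 isT.
  by rewrite /in_strip /index_walls /value_walls /=; perm_lia.
have mj' : pi m <> pi j :> nat by rewrite perm_val_eq; lia.
have mk' : pi m <> pi k :> nat by rewrite perm_val_eq; lia.
have := box 3 1 isT; have := box 3 2 isT; have := box 3 3 isT.
by rewrite /in_strip /index_walls /value_walls /=; perm_lia.
Qed.

(** * Application of the counting argument to sets of low boxes *)

Section LowBoxes.

Variable T : {set 'I_4 * 'I_4}.
Hypothesis T_low : forall ab, ab \in T -> (val ab.1, val ab.2) \in low_boxes.

Section FixedSize.

Variable n : nat.
Implicit Types (pi : 'S_n) (i j k : 'I_n) (f : {ffun 'I_3 -> 'I_n}).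

(** The instance of [P] for the counting argument: an occurrence of either of the two patterns. *)
Definition pattern_at pi i j k : bool :=
  [&& i < j < k, pi i < pi j, pi i < pi k,
      [forall m : 'I_n, (i < m) ==> (pi i < pi m) ==>
        [|| m == j :> nat, m == k :> nat
          | [&& m < j, pi m < pi j & pi m < pi k]]]
    & [forall ab in T, forall m : 'I_n,
        ~~ (in_strip (index_walls i j k) (val ab.1) m
            && in_strip (value_walls pi i j k) (val ab.2) (pi m))]].

Lemma pattern_atP pi i j k :
  reflect (quadrant_pair pi i j k /\
           forall ab, ab \in T -> box_free pi i j k (val ab.1, val ab.2))
          (pattern_at pi i j k).
Proof.
apply: (iffP and5P) =>
  [[ijk uj uk /forallP q /forallP free]|[[ijk uj uk q] free]].
  split=> [|ab abT m]; last by move/implyP: (free ab) => /(_ abT)/forallP/(_ m).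
  by split=> // m im um; move: (q m); rewrite im um.
split=> //.
  by apply/forallP=> m; apply/implyP=> im; apply/implyP; apply: q.
by apply/forallP=> ab; apply/implyP=> abT; apply/forallP=> m; apply: free.
Qed.

Lemma pattern_at_uniq pi i j k b c :
  pattern_at pi i j k -> pattern_at pi i b c -> (b = j) * (c = k).
Proof.
move=> /pattern_atP[Q _] /pattern_atP[Q' _].
(* For equal first points, every case but [SamePair] contains [i < i]. *)
by case: (quadrant_pairP Q Q') => // [|||]; rewrite ltnn.
Qed.

Lemma pattern_at_lt pi i j k : pattern_at pi i j k -> j < k.
Proof. by case/and5P => /andP[]. Qed.

Lemma pattern_at_swap pi i j k :
  pattern_at pi i j k -> pattern_at (tperm j k * pi)%g i j k.
Proof.
move=> /pattern_atP[Q free]; apply/pattern_atP; split; first exact: swap_same.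
by move=> ab abT; apply: swap_same_box (T_low abT) (free _ abT).
Qed.

Lemma pattern_at_follow pi i j k a b c :
  pattern_at pi i j k -> pattern_at pi a b c -> ~ (b = j /\ c = k) ->
  let c' := if b < i then tperm j k c else c in
  let sigma := (tperm j k * pi)%g in
  pattern_at sigma a b c' /\ (sigma b < sigma c') = (pi b < pi c).
Proof.
move=> /pattern_atP[Q _] /pattern_atP[Q' free] ne /=.
have [Qs lt_s frees] := swap_linked Q Q' ne.
split=> //; apply/pattern_atP; split=> // ab abT.
by apply: frees (T_low abT) (free _ abT).
Qed.

(** Both 123 and 132 fix [ord0]. This makes the other two values of [q] positive and reduces the
    nine comparisons to three. *)
Lemma order_isoE (q : 'S_3) pi f : q ord0 = ord0 -> f at1 < f at2 ->
  order_iso (q, shadedD :|: T) pi f =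
  [&& pi (f ord0) < pi (f at1), pi (f ord0) < pi (f at2)
    & (pi (f at1) < pi (f at2)) == (q at1 < q at2)].
Proof.
move=> q0 f12.
have q_gt0 x : x != ord0 -> 0 < q x.
  by rewrite -(inj_eq (@perm_inj _ q)) q0 -(inj_eq val_inj) lt0n.
have q1 : 0 < q at1 by rewrite q_gt0 // -(inj_eq val_inj) /= at1E.
have q2 : 0 < q at2 by rewrite q_gt0 // -(inj_eq val_inj) /= at2E.
have q12 : q at1 <> q at2 :> nat by rewrite perm_val_eq at1E at2E.
have pi12 : pi (f at1) <> pi (f at2) :> nat by rewrite perm_val_eq; lia.
rewrite /order_iso forall_I3 !forall_I3 /= q0 !ltnn !ltn0 q1 q2 /=.
move: (q at1 : nat) (q at2 : nat) (pi (f ord0) : nat) q12 pi12 => x y z.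
move: (pi (f at1) : nat) (pi (f at2) : nat) => v w; lia.
Qed.

Lemma box_emptyE (q : mesh_pattern 3) pi f a b :
  pi (f ord0) < pi (f at1) -> pi (f ord0) < pi (f at2) ->
  reflect (box_free pi (f ord0) (f at1) (f at2) (a, b)) (box_empty pi f a b).
Proof.
move=> lt1 lt2; rewrite /box_empty index_boundsE value_boundsE // negb_exists.
exact: forallP.
Qed.

Lemma occurrenceE (q : 'S_3) pi f : q ord0 = ord0 ->
  occurrence (q, shadedD :|: T) pi f =
  pattern_at pi (f ord0) (f at1) (f at2)
  && ((pi (f at1) < pi (f at2)) == (q at1 < q at2)).
Proof.
move=> q0; apply/and3P/andP; rewrite increasingE.
  case=> inc; have /andP[f01 f12] := inc.
  rewrite order_isoE // => /and3P[lt1 lt2 up] /forall_inP free; split=> //.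
  apply/pattern_atP; split=> [|ab abT].
    apply/quadrant_pair_shadedD; split=> //.
    apply/(@forall_boxes 3) => // ab abD; apply/box_emptyE => //.
    by apply: free; rewrite inE abD.
  by apply/box_emptyE => //; apply: free; rewrite inE abT orbT.
case=> /pattern_atP[Q freeT] up; have [inc lt1 lt2 _] := Q.
have /andP[f01 f12] := inc; split=> //; first by rewrite order_isoE // lt1 lt2.
apply/forall_inP=> ab /setUP[abD|abT]; apply/box_emptyE => //.
  have /quadrant_pair_shadedD[_ _ _ freeD] := Q.
  by move: ab abD; apply/(@forall_boxes 3).
exact: freeT.
Qed.

(** By [pattern_at_uniq], evaluation at [ord0] is injective on occurrences. *)
Lemma num_occE (q : 'S_3) pi : q ord0 = ord0 ->
  num_occ (q, shadedD :|: T) pi =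
  #|[set i | occurs pattern_at pi (q at1 < q at2) i]|.
Proof.
move=> q0; rewrite /num_occ.
rewrite -(card_in_imset (f := fun f => f ord0)); last first.
  move=> f g; rewrite !inE !occurrenceE // => /andP[pf _] /andP[pg _] e.
  rewrite e in pf; have [e1 e2] := pattern_at_uniq pf pg.
  apply/ffunP=> x; have: x \in enum 'I_3 by rewrite mem_enum.
  by rewrite enum_I3 !inE => /or3P[] /eqP->.
apply: eq_card => i; rewrite inE; apply/imsetP/occursP.
  case=> f; rewrite inE occurrenceE // => /andP[p /eqP up] ->.
  by exists (f at1), (f at2).
case=> j [k [p up]].
exists [ffun x : 'I_3 => if x == ord0 then i else if x == at1 then j else k].
  rewrite inE occurrenceE // !ffunE !eqxx.
  by rewrite -!(inj_eq val_inj) /= at1E at2E /= p up eqxx.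
by rewrite ffunE eqxx.
Qed.

End FixedSize.

(** The last two values ascend in [perm123] and descend in [perm132], so the two counts are those
    for [up] true and [up] false. *)
Lemma equidistributed_low_boxes :
  equidistributed (perm123, shadedD :|: T) (perm132, shadedD :|: T).
Proof.
have p0 : perm123 ord0 = ord0 by rewrite perm1.
have q0 : perm132 ord0 = ord0.
  by rewrite tpermD // -(inj_eq val_inj) /= inordK.
have p12 : (perm123 at1 < perm123 at2) = true by rewrite !perm1 at1E at2E.
have q12 : (perm132 at1 < perm132 at2) = false.
  by rewrite /perm132 tpermL tpermR -/at1 -/at2 at1E at2E.
move=> n l; have num_occ_set (q : 'S_3) : q ord0 = ord0 ->
    #|[set pi : 'S_n | num_occ (q, shadedD :|: T) pi == l]| =
    #|[set pi : 'S_n |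
         #|[set i | occurs (@pattern_at n) pi (q at1 < q at2) i]| == l]|.
  by move=> q0'; apply: eq_card => pi; rewrite !inE num_occE.
rewrite !num_occ_set // p12 q12.
exact: card_occurs_symmetric (@pattern_at_uniq n) (@pattern_at_lt n)
  (@pattern_at_swap n) (@pattern_at_follow n) l.
Qed.

End LowBoxes.

Theorem theorem4p7 (T : {set 'I_4 * 'I_4}) :
  T \in [:: boxes 3 [:: (0, 0)];
            boxes 3 [:: (0, 1); (1, 0)];
            boxes 3 [:: (0, 0); (0, 1); (1, 0)];
            boxes 3 [:: (0, 2); (2, 0)];
            boxes 3 [:: (0, 0); (0, 2); (2, 0)];
            boxes 3 [:: (0, 1); (0, 2); (1, 0); (2, 0)];
            boxes 3 [:: (0, 0); (0, 1); (0, 2); (1, 0); (2, 0)]] ->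
  equidistributed (perm123, shadedD :|: T) (perm132, shadedD :|: T).
Proof.
have low s : all (mem low_boxes) s ->
    forall ab, ab \in boxes 3 s -> (val ab.1, val ab.2) \in low_boxes.
  by move/allP=> s_low ab; rewrite inE => /s_low.
rewrite !inE => T_in; apply: equidistributed_low_boxes.
by move: T_in; do 6?[case/orP]; move=> /eqP->; apply: low.
Qed.
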